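(* Let $G$ be a torsion-free abelian group with identity element $e$ and let $R$ be a $G$-graded ring. Then every central idempotent in $R$ is contained in $R_e$.
   Context: Rings are associative but not necessarily unital and not necessarily commutative. A ring $R$ is $G$-graded if there is a collection of additive subgroups $\{R_g\}_{g\in G}$ of $R$ such that $R=\bigoplus_{g\in G} R_g$ and $R_gR_h\subseteq R_{gh}$ for all $g,h\in G$. *)

(* Defs.v *)
From HB Require Import structures.
From mathcomp Require Import all_boot all_order all_algebra.
From mathcomp Require Import boolp classical_sets.

Set Implicit Arguments.
Unset Strict Implicit.
Unset Printing Implicit Defensive.

Import GRing.Theory.
Local Open Scope ring_scope.

(** Associative rings, without unit or commutativity assumption. MathComp's
    ring structures are all unital, so this one joins [zmodType] (addition,
    in [ring_scope]) and [semigroupType] (product, written [(x * y)%g]). *)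
HB.mixin Record Zmodule_Semigroup_isRng R
    of GRing.Zmodule R & Semigroup R := {
  rng_mulDl : @left_distributive R R *%g +%R;
  rng_mulDr : @right_distributive R R *%g +%R
}.

#[short(type="rngType")]
HB.structure Definition Rng :=
  {R of Zmodule_Semigroup_isRng R & GRing.Zmodule R & Semigroup R}.

Definition torsion_free (G : groupType) : Prop :=
  forall (x : G) (n : nat), (0 < n)%N -> (x ^+ n = 1)%g -> x = 1%g.

Definition additive_subgroup (V : zmodType) (A : set V) : Prop :=
  A 0 /\ (forall x y, A x -> A y -> A (x - y)).

(** [V] is the internal direct sum of the family [A]; finite sums over the
    possibly infinite [I] are sums over duplicate-free sequences of indices. *)
Record direct_sum_decomposition (I : choiceType) (V : zmodType)
    (A : I -> set V) : Prop := {
  dsum_subgroup : forall i, additive_subgroup (A i);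
  dsum_spans : forall x : V, exists (s : seq I) (f : I -> V),
    [/\ uniq s, forall i, A i (f i) & x = \sum_(i <- s) f i];
  dsum_direct : forall (s : seq I) (f : I -> V),
    uniq s -> (forall i, A i (f i)) -> \sum_(i <- s) f i = 0 ->
    forall i, i \in s -> f i = 0
}.

Record grading (G : groupType) (R : rngType) (A : G -> set R) : Prop := {
  grading_dsum : direct_sum_decomposition A;
  grading_mul : forall (g h : G) (x y : R),
    A g x -> A h y -> A (g * h)%g (x * y)%g
}.

Definition idempotent_elt (R : rngType) (x : R) : Prop := (x * x)%g = x.

Definition central_elt (R : rngType) (x : R) : Prop := forall y : R, commute x y.

(* Main.v *)
Require Import Defs.
From mathcomp Require Import all_boot all_order all_algebra.
From mathcomp Require Import boolp classical_sets.

(** Write the central idempotent as [x = \sum_g c g] with [c g] homogeneous of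
    degree [g]. Comparing degrees in [x y = y x] for homogeneous [y] shows that
    the [c g] commute with each other ([central_components_commute]; this is
    where commutativity of [G] enters the ring side), and comparing degrees in
    [x x = x] gives [c g = \sum_h c h c (h^-1 g)]
    ([idempotent_components_convolution]). What remains is a statement about
    the family [c]: such a family vanishes away from the identity.

    The classical reason is that the component of [x] of highest degree, in
    some total order on [G], squares to zero, so that a nonidentity component
    is zero modulo nilpotents; idempotents are then lifted. The proof below
    needs neither quotient rings nor nilpotents, because it works with
    annihilators. For every [z] in the ring it shows [z c g = 0] whenever
    [g <> 1] ([mul_nonidentity_component_eq0]), by induction on the number of
    [g <> 1] with [z c g <> 0]:
    - an extreme such degree [a] satisfies [z c a c a = 0], so the induction
      hypothesis applies to [z c a] and gives [z c a c b = 0] for [b <> 1];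
    - this says that [a] is lost when [z] is replaced by [z c b], so the
      induction hypothesis applies to [z c b] as well: [z c b c g = 0] for all
      [b, g <> 1], and only the products with a factor [c 1] survive;
    - hence [z c 1 = z c 1 c 1] and [z c g = z c 1 c g + z c g c 1]. Multiplying
      the second identity by [c 1] gives [z c g c 1 = z c g c 1 + z c g c 1],
      hence [z c g c 1 = 0], and then [z c g = 0].
    Finally each term [c h c (h^-1 g)] of [c g] has, for [g <> 1], a factor of
    nonidentity degree, and therefore vanishes.

    The extreme degree comes from a total order on [G], encoded by its strictly
    positive elements and obtained from Zorn's lemma
    ([exists_total_strict_cone], [exists_extreme]). *)

Set Implicit Arguments.
Unset Strict Implicit.
Unset Printing Implicit Defensive.

Import GRing.Theory.
Local Open Scope ring_scope.

(** * Ordering a torsion-free abelian group *)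

Section Ordering.
Variable G : groupType.
Local Open Scope group_scope.

(** Such a [P] is the set of positive elements of the left-invariant strict
    partial order [g < h <-> P (g^-1 * h)]. Leaving the identity out,
    rather than in, makes the empty set a cone, so that the union of an empty
    chain of cones is one. *)
Definition strict_cone (P : set G) : Prop :=
  (forall x y, P x -> P y -> P (x * y)) /\ ~ P 1.

Definition total_strict_cone (P : set G) : Prop :=
  strict_cone P /\ forall x, x <> 1 -> P x \/ P x^-1.

Hypotheses (G_abelian : forall g h : G, commute g h).
Hypothesis (G_torsion_free : torsion_free G).

(** Otherwise the semigroup generated by [P] and [x] would still avoid the
    identity: [p x^n = 1] with [p] in [P] means that [x^-n = p] is in [P], and
    [x^n = 1] is excluded by torsion-freeness. *)
Lemma maximal_cone_power (P : set G) (x : G) :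
    strict_cone P -> (forall Q, (P `<` Q)%classic -> ~ strict_cone Q) ->
  x <> 1 -> ~ P x -> exists2 n, (0 < n)%N & P (x^-1 ^+ n).
Proof.
move=> [PM P1] Pmax x_neq1 nPx; apply: contrapT => noP.
pose Q : set G := fun y => exists p n,
  (P p \/ p = 1 /\ (0 < n)%N) /\ y = p * x ^+ n.
have PQ : (P `<=` Q)%classic.
  by move=> p Pp; exists p, 0%N; rewrite expg0 mulg1; split; first left.
have Qx : Q x by exists 1, 1%N; rewrite expg1 mul1g; split; first right.
apply: (Pmax Q); first by split=> // QP; exact/nPx/QP.
split=> [_ _ [p [m [pP ->]]] [q [n [qP ->]]]|[p [n [pP p_xn]]]].
  exists (p * q), (m + n)%N; split; last first.
    by rewrite expgnDr mulgA -(mulgA p) (G_abelian (x ^+ m) q) !mulgA.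
  case: pP qP => [Pp|[-> m_gt0]] [Pq|[-> n_gt0]]; rewrite ?mul1g ?mulg1.
  - by left; exact: PM.
  - by left.
  - by left.
  - by right; rewrite addn_gt0 m_gt0.
case: pP => [Pp|[p1 n_gt0]].
  have pE : p = x ^- n by apply: (mulIg (x ^+ n)); rewrite mulVg.
  case: n => [|n] in p_xn pE; first by rewrite pE expg0 invg1 in Pp.
  by apply: noP; exists n.+1; rewrite // expVgn -pE.
by apply: x_neq1; apply: (G_torsion_free n_gt0); rewrite p_xn p1 mul1g.
Qed.

(** In a maximal cone containing neither [x] nor its inverse, some [x^-m] and
    some [x^n] would be positive, and so would be [x^-(mn) x^(mn) = 1]. *)
Lemma exists_total_strict_cone : exists P : set G, total_strict_cone P.
Proof.
have [F FP Ftot|P [Pcone Pmax]] := @Zorn_bigcup G strict_cone.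
  split=> [x y [A FA Ax] [B FB By]|[A FA A1]]; last by case: (FP A FA).
  case: (Ftot A B FA FB) => [AB|BA].
    by exists B => //; case: (FP B FB) => BM _; apply: BM => //; exact: AB.
  by exists A => //; case: (FP A FA) => AM _; apply: AM => //; exact: BA.
exists P; split=> // x x_neq1; apply: contrapT => /not_orP[nPx nPVx].
have xV_neq1 : x^-1 <> 1 by move/eqP; rewrite invg_eq1 => /eqP.
have [m m_gt0 Pm] := maximal_cone_power Pcone Pmax x_neq1 nPx.
have [n n_gt0 Pn] := maximal_cone_power Pcone Pmax xV_neq1 nPVx.
case: Pcone => PM P1; rewrite invgK in Pn.
have PX y k : P y -> (0 < k)%N -> P (y ^+ k).
  case: k => // k Py _; elim: k => // k IHk.
  by rewrite expgS; exact: PM.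
apply: P1; rewrite -(mulVg (x ^+ (m * n))) -expVgn expgnA (mulnC m) expgnA.
by apply: PM; exact: PX.
Qed.

Lemma total_strict_cone_max (P : set G) (T : seq G) :
    total_strict_cone P -> T != [::] ->
  exists2 a, a \in T & forall h, h \in T -> h <> a -> P (h^-1 * a).
Proof.
move=> [[PM P1] Ptot]; elim: T => // x [_ _|y T /(_ isT)[a aT amax] _].
  by exists x; rewrite ?mem_head // => h; rewrite inE => /eqP.
have [->|/eqP xa] := eqVneq x a.
  exists a; rewrite ?mem_head // => h; rewrite inE => /orP[/eqP|] //.
  exact: amax.
have [|Pxa|] := Ptot (x^-1 * a).
- by move/mulg1_eq; rewrite invgK.
- exists a => [|h]; first by rewrite inE aT orbT.
  by rewrite inE => /orP[/eqP-> //|]; exact: amax.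
rewrite invgM invgK => Pax; exists x; rewrite ?mem_head // => h.
rewrite inE => /orP[/eqP //|hT] _; have [->//|/eqP ha] := eqVneq h a.
by rewrite -[h^-1](mulgK a) -mulgA; apply: PM => //; exact: amax.
Qed.

(** The largest element [a] of [T] has this property as soon as it is
    positive: then [a < a^2], and [a^2] is not a product of two elements of [T]
    other than [a a]. The largest element may be negative, but one of the
    order and its opposite makes a given element of [T] positive, hence the
    largest one too. *)
Lemma exists_extreme (T : seq G) : T != [::] -> 1 \notin T ->
  exists a, [/\ a \in T, a * a \notin T
    & forall h, h \in T -> h^-1 * (a * a) \in T -> h = a].
Proof.
move=> T_neq0 T1.
have T_neq1 g : g \in T -> g <> 1 by move=> gT g1; rewrite -g1 gT in T1.
have [P Ptot [t tT Pt]] :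
    exists2 P, total_strict_cone P & exists2 t, t \in T & P t.
  case: T T_neq0 T_neq1 {T1} => // t T _ T_neq1.
  have [P Ptot] := exists_total_strict_cone; have [[PM P1] Ptot'] := Ptot.
  have [Pt|PtV] := Ptot' t (T_neq1 t (mem_head t T)).
    by exists P => //; exists t; rewrite ?mem_head.
  exists (fun x => P x^-1); last by exists t; rewrite ?mem_head.
  split; first split.
  - by move=> x y Px Py; rewrite invgM; exact: PM.
  - by rewrite invg1.
  - by move=> x /Ptot'; rewrite invgK => -[]; [right|left].
have [a aT amax] := total_strict_cone_max Ptot T_neq0.
case: Ptot => [[PM P1] _].
have Pa : P a.
  have [<-//|/eqP ta] := eqVneq t a.
  by rewrite -(mulVKg t a); apply: PM => //; exact: amax.
exists a; split=> // [|h hT kT].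
  apply/negP => aaT; apply: P1; rewrite -(mulVg a); apply: PM => //.
  have := amax _ aaT; rewrite invgM mulgVK; apply.
  by move=> aa; apply: (T_neq1 a aT); apply: (mulIg a); rewrite mul1g.
apply: contrapT => ha; apply: P1.
have kE : h^-1 * (a * a) = a * (h^-1 * a) by rewrite mulgA; exact: G_abelian.
have ka : h^-1 * (a * a) <> a.
  by move=> E; apply: ha; apply: (mulIg a); rewrite -[X in h * X]E mulVKg.
rewrite -(mulgV (h^-1 * a)); apply: PM; first exact: amax.
by have := amax _ kT ka; rewrite kE invgM mulgVK.
Qed.

End Ordering.

(** * Sums and products in rings without unit *)

Lemma big_uniq_support (V : nmodType) (I : eqType) (s t : seq I) (F : I -> V) :
    uniq s -> uniq t ->
    (forall i, i \in s -> i \notin t -> F i = 0) ->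
    (forall i, i \in t -> i \notin s -> F i = 0) ->
  \sum_(i <- s) F i = \sum_(i <- t) F i.
Proof.
move=> s_uniq t_uniq Fs Ft.
rewrite (bigID [in t]) /= [X in _ + X]big_seq_cond [X in _ + X]big1 ?addr0.
rewrite [RHS](bigID [in s]) /= [X in _ + X]big_seq_cond [X in _ + X]big1 ?addr0.
- rewrite -big_filter -[RHS]big_filter; apply: perm_big; apply: uniq_perm.
  + exact: filter_uniq.
  + exact: filter_uniq.
  + by move=> i; rewrite !mem_filter andbC.
- by move=> i /andP[]; exact: Ft.
- by move=> i /andP[]; exact: Fs.
Qed.

Section RngTheory.
Variable R : rngType.
Implicit Types (x y : R) (I : Type).

Lemma rng_mul0r x : (0 * x)%g = 0 :> R.
Proof. by apply: (addrI (0 * x)%g); rewrite -rng_mulDl !addr0. Qed.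

Lemma rng_mulr0 x : (x * 0)%g = 0 :> R.
Proof. by apply: (addrI (x * 0)%g); rewrite -rng_mulDr !addr0. Qed.

Lemma rng_mul_suml I (s : seq I) (F : I -> R) x :
  ((\sum_(i <- s) F i) * x)%g = \sum_(i <- s) (F i * x)%g.
Proof.
by apply: (big_morph (fun y => (y * x)%g)) => [y z|];
  rewrite ?rng_mulDl ?rng_mul0r.
Qed.

Lemma rng_mul_sumr I (s : seq I) (F : I -> R) x :
  (x * \sum_(i <- s) F i)%g = \sum_(i <- s) (x * F i)%g.
Proof.
by apply: (big_morph (fun y => (x * y)%g)) => [y z|];
  rewrite ?rng_mulDr ?rng_mulr0.
Qed.

End RngTheory.

(** * Idempotents of a convolution *)

Section ConvolutionIdempotent.
Variables (G : groupType) (R : rngType).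
Hypotheses (G_abelian : forall g h : G, commute g h).
Hypothesis (G_torsion_free : torsion_free G).
Variables (s : seq G) (c : G -> R).
Hypothesis s_uniq : uniq s.
Hypothesis c_support : forall g, g \notin s -> c g = 0.
Hypothesis c_comm : forall g h, commute (c g) (c h).
Hypothesis c_idem : forall g, c g = \sum_(h <- s) (c h * c (h^-1 * g))%g.

(** The convolution formula may be summed over any [t] that carries the terms
    surviving multiplication by [z]; in the applications [t] has one or two
    elements, whether or not they belong to [s]. *)
Lemma mul_component (z : R) (g : G) (t : seq G) : uniq t ->
    (forall h, h \notin t -> (z * (c h * c (h^-1 * g)))%g = 0) ->
  (z * c g)%g = \sum_(h <- t) (z * (c h * c (h^-1 * g)))%g.
Proof.
move=> t_uniq zt; rewrite {1}c_idem rng_mul_sumr.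
apply: big_uniq_support => // h _; first exact: zt.
by move=> hs; rewrite c_support // rng_mul0r rng_mulr0.
Qed.

(** The multiplier [z] is there for the induction: passing from [z] to [z c b]
    plays the part of passing to a quotient of the ring, and the set of
    degrees [g] with [z c g = 0] only grows. *)
Lemma mul_nonidentity_component_eq0 (z : R) (g : G) :
  g <> 1%g -> (z * c g)%g = 0.
Proof.
pose supp z : seq G := [seq g <- s | (g != 1%g) && ((z * c g)%g != 0)].
have suppN y h : h \notin supp y -> h <> 1%g -> (y * c h)%g = 0.
  move=> hs h1; apply: contrapT => /eqP yh; move/negP: hs; apply.
  rewrite mem_filter yh; move/eqP: (h1) => -> /=; apply: contraT => hs.
  by rewrite c_support // rng_mulr0 eqxx in yh.
have [n] := ubnP (size (supp z)); elim: n z g => // n IHn z g size_z g1.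
have [z0|z_neq0] := eqVneq (supp z) [::].
  by apply: suppN => //; rewrite z0.
have supp1 : 1%g \notin supp z by rewrite mem_filter eqxx.
have [a [az aaz a_extreme]] :=
  exists_extreme G_abelian G_torsion_free z_neq0 supp1.
have mulCA y h k : (y * c h * c k)%g = (y * c k * c h)%g.
  by rewrite -!mulgA c_comm.
have mulK0 y h k : (y * c h)%g = 0 -> (y * (c k * c h))%g = 0.
  by move=> yh; rewrite mulgA mulCA yh rng_mul0r.
have a1 : a <> 1%g by apply/eqP; move: az; rewrite mem_filter => /andP[/andP[]].
have aa1 : (a * a)%g <> 1%g.
  by move=> aa; apply: a1; apply: (G_torsion_free (n := 2)).
(* At degree [a a], every term of the convolution except [c a c a] has a
   factor killed by [z], and so is [c (a a)] itself. *)
have caa : (z * c a * c a)%g = 0.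
  rewrite -mulgA; have := @mul_component z (a * a)%g [:: a] isT.
  rewrite big_seq1 mulKg => <- => [|h]; first exact: suppN.
  rewrite inE => /eqP ha.
  have [h1|/eqP h1] := eqVneq h 1%g.
    by apply: mulK0; rewrite h1 invg1 mul1g; exact: suppN.
  have [hz|hz] := boolP (h \in supp z); last first.
    by rewrite mulgA (suppN z h) // rng_mul0r.
  apply: mulK0; apply: suppN; first by apply/negP => /(a_extreme _ hz).
  by move/mulg1_eq; rewrite invgK => haa; rewrite -haa hz in aaz.
(* The induction hypothesis in the form used twice below: [y] kills all that
   [z] kills, and [c a] besides. *)
have shrink y : (forall h, (z * c h)%g = 0 -> (y * c h)%g = 0) ->
    (y * c a)%g = 0 -> forall h, h <> 1%g -> (y * c h)%g = 0.
  move=> zy ya h; apply: IHn; rewrite -ltnS (leq_trans _ size_z) // ltnS.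
  have a_supp : a \notin supp y by rewrite mem_filter ya eqxx andbF.
  suff: (size (a :: supp y) <= size (supp z))%N by [].
  apply: uniq_leq_size => [|k]; first by rewrite /= a_supp filter_uniq.
  rewrite inE => /orP[/eqP-> //|]; rewrite !mem_filter -!andbA.
  case/and3P=> -> yk ->; rewrite andbT /=.
  by apply: contra yk => /eqP /zy ->.
have mul0CA h k : (z * c k)%g = 0 -> (z * c h * c k)%g = 0.
  by move=> zk; rewrite mulCA zk rng_mul0r.
have z2 b h : b <> 1%g -> h <> 1%g -> (z * c b * c h)%g = 0.
  move=> b1; apply: (shrink) => [k|]; first exact: mul0CA.
  (* [a] leaves the support because [z c a] kills [c b], which is the first
     use of the induction hypothesis. *)
  by rewrite mulCA; apply: shrink => // k; exact: mul0CA.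
have z1 : (z * c 1%g)%g = (z * c 1%g * c 1%g)%g.
  have := @mul_component z 1%g [:: 1%g] isT.
  rewrite big_seq1 mulgA invg1 mul1g; apply=> h.
  rewrite inE mulg1 mulgA => /eqP h1; apply: z2 => // /eqP.
  by rewrite invg_eq1 => /eqP.
have zg : (z * c g)%g = (z * c 1%g * c g)%g + (z * c g * c 1%g)%g.
  have := @mul_component z g [:: 1%g; g]; rewrite big_cons big_seq1.
  rewrite invg1 mul1g mulVg !mulgA; apply.
    by rewrite /= inE andbT eq_sym; apply/eqP.
  move=> h; rewrite !inE negb_or => /andP[/eqP h1 /eqP hg].
  rewrite mulgA; apply: z2 => // /mulg1_eq; rewrite invgK => hg'.
  exact: hg.
suff zg1 : (z * c g * c 1%g)%g = 0 by rewrite zg mulCA zg1 addr0.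
(* [z c g c 1] equals its own double. *)
apply: (addrI (z * c g * c 1%g)%g); rewrite addr0.
rewrite [RHS](congr1 (fun y => y * c 1)%g zg).
by rewrite rng_mulDl !(mulCA _ g 1%g) -!z1.
Qed.

Lemma nonidentity_component_eq0 (g : G) : g <> 1%g -> c g = 0.
Proof.
move=> g1; rewrite c_idem big1_seq // => h _.
have [h1|/eqP h1] := eqVneq h 1%g.
  by rewrite h1 invg1 mul1g; exact: mul_nonidentity_component_eq0.
by rewrite c_comm; exact: mul_nonidentity_component_eq0.
Qed.

End ConvolutionIdempotent.

(** * Homogeneous components *)

Section Components.
Variables (G : groupType) (R : rngType) (R_ : G -> set R).
Hypotheses (G_abelian : forall g h : G, commute g h).
Hypothesis (R_graded : grading R_).

Lemma homogeneousB g x y : R_ g x -> R_ g y -> R_ g (x - y).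
Proof.
by case: (dsum_subgroup (grading_dsum R_graded) g) => _; apply.
Qed.

Lemma homogeneous0 g : R_ g 0.
Proof. by case: (dsum_subgroup (grading_dsum R_graded) g). Qed.

Lemma homogeneous_sum (I : eqType) (s : seq I) (F : I -> R) g :
  (forall i, R_ g (F i)) -> R_ g (\sum_(i <- s) F i).
Proof.
move=> RF; apply: big_ind => [|x y Rx Ry|//]; first exact: homogeneous0.
rewrite -[y]opprK; apply: homogeneousB => //; rewrite -sub0r.
exact/homogeneousB/Ry/homogeneous0.
Qed.

(** Extending the components by zero outside [s] lets degrees be shifted and
    compared without tracking membership in [s]. *)
Lemma homogeneous_decomposition (x : R) : exists (s : seq G) (c : G -> R),
  [/\ uniq s, forall g, R_ g (c g), forall g, g \notin s -> c g = 0
    & x = \sum_(g <- s) c g].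
Proof.
have [s [f [s_uniq Rf ->]]] := dsum_spans (grading_dsum R_graded) x.
exists s, (fun g => if g \in s then f g else 0); split=> // [g|g /negPf->//|].
  by case: ifP => // _; exact: homogeneous0.
by apply: eq_big_seq => g ->.
Qed.

Variables (s : seq G) (c : G -> R).
Hypothesis s_uniq : uniq s.
Hypothesis c_support : forall g, g \notin s -> c g = 0.
Hypothesis c_homogeneous : forall g, R_ g (c g).
Let x : R := \sum_(g <- s) c g.

(** For [y = c h], the degree [g h] part of [x y] is [c g c h], and that of
    [y x] is [c h c g], because [h g = g h]. *)
Lemma central_components_commute :
  central_elt x -> forall g h, commute (c g) (c h).
Proof.
move=> x_central g h.
have [gs|gs] := boolP (g \in s); last first.
  by rewrite /commute c_support // rng_mul0r rng_mulr0.
apply/eqP; rewrite -subr_eq0; apply/eqP.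
(* The component of degree [k] of [x c h - c h x]. *)
pose d k := (c (k * h^-1) * c h)%g - (c h * c (k * h^-1))%g.
suff : d (g * h)%g = 0 by rewrite /d mulgK.
apply: (dsum_direct (grading_dsum R_graded) (s := [seq k * h | k <- s]%g)).
- by rewrite map_inj_uniq //; exact: mulIg.
- move=> k; rewrite -{1}(mulgVK h k) /d; apply: homogeneousB.
    exact: (grading_mul R_graded).
  rewrite G_abelian; exact: (grading_mul R_graded).
- rewrite big_map; under eq_bigr do rewrite /d mulgK.
  by rewrite sumrB -rng_mul_suml -rng_mul_sumr x_central subrr.
- exact: map_f.
Qed.

Lemma idempotent_components_convolution : idempotent_elt x ->
  forall g, c g = \sum_(h <- s) (c h * c (h^-1 * g))%g.
Proof.
move=> x_idem g.
(* All degrees that may occur in [x - x x], together with [g]; [d k] is the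
   component of degree [k]. *)
pose t := undup (g :: s ++ [seq (h * k)%g | h <- s, k <- s]).
pose d k := c k - \sum_(h <- s) (c h * c (h^-1 * k))%g.
apply/eqP; rewrite -subr_eq0; apply/eqP; rewrite -/(d g).
apply: (dsum_direct (grading_dsum R_graded) (s := t)); first exact: undup_uniq.
- move=> k; apply: homogeneousB => //; apply: homogeneous_sum => h.
  by rewrite -{1}(mulVKg h k); exact: (grading_mul R_graded).
- rewrite sumrB exchange_big /=; apply/eqP; rewrite subr_eq0; apply/eqP.
  transitivity x.
    apply: big_uniq_support; rewrite ?undup_uniq // => k kst.
      exact: c_support.
    by rewrite /t mem_undup inE mem_cat kst orbT.
  rewrite -x_idem rng_mul_suml; apply: eq_big_seq => h hs.
  rewrite -rng_mul_sumr -(big_map (fun k => h^-1 * k)%g xpredT c).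
  congr (_ * _)%g; apply: big_uniq_support => //.
  + by rewrite map_inj_uniq ?undup_uniq //; exact: mulgI.
  + move=> k ks /negP[]; apply/mapP; exists (h * k)%g; last by rewrite mulKg.
    by rewrite /t mem_undup inE mem_cat (allpairs_f _ hs ks) !orbT.
  + by move=> k _; exact: c_support.
- by rewrite /t mem_undup mem_head.
Qed.

End Components.

Theorem corollary1 (G : groupType) (G_abelian : forall g h : G, commute g h)
  (G_torsion_free : torsion_free G) (R : rngType) (R_ : G -> set R)
  (R_graded : grading R_) (x : R) :
  idempotent_elt x -> central_elt x -> R_ 1%g x.
Proof.
have [s [c [s_uniq Rc c_supp ->]]] := homogeneous_decomposition R_graded x.
move=> x_idem x_central.
have c_comm := central_components_commute G_abelian R_graded s_uniq c_supp
  Rc x_central.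
have c_conv := idempotent_components_convolution R_graded s_uniq c_supp
  Rc x_idem.
have c0 := nonidentity_component_eq0 G_abelian G_torsion_free s_uniq c_supp
  c_comm c_conv.
rewrite (big_uniq_support (t := [:: 1%g])) // => [|g _|g _].
- by rewrite big_seq1.
- by rewrite inE => /eqP; exact: c0.
- exact: c_supp.
Qed.
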